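(* Consider a reversible Markov decision problem (RMDP) defined by transition probability matrices $(P(u) : u \in \mathcal{U})$ on $\mathcal{X}$, $P(u) = [p_{ij}(u)]$, and a reward function $r : \mathcal{X} \times \mathcal{U} \to \mathbb{R}$. Let $G = (\mathcal{X}, \mathcal{E})$ be its canonical graph, and suppose that $G$ is biconnected. Then there is an irreducible reversible transition probability matrix $P^{(0)} = [p^{(0)}_{ij}]$ on $\mathcal{X}$ such that $p^{(0)}_{ij} > 0$ if and only if $(i,j) \in \mathcal{E}$, and there is a function $\rho : \mathcal{X} \times \mathcal{U} \to (0,1]$, such that for each $u \in \mathcal{U}$ we have $$p_{ij}(u) = \rho(i,u)\, p^{(0)}_{ij} \ \text{ for } j \neq i, \qquad p_{ii}(u) = 1 - \rho(i,u).$$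
   Context: $\mathcal{X}$ (states) and $\mathcal{U}$ (actions) are finite sets, each of cardinality at least $2$. For each $u \in \mathcal{U}$, $P(u) = [p_{ij}(u)]$ is a transition probability matrix (row-stochastic matrix) on $\mathcal{X}$, and $r : \mathcal{X} \times \mathcal{U} \to \mathbb{R}$ is a reward function. A stationary randomized Markov strategy $\mu$ is a choice, for each $i \in \mathcal{X}$, of a probability distribution $(\mu(u|i) : u \in \mathcal{U})$ on $\mathcal{U}$; $\mathcal{M}$ is the set of all such strategies. For $\mu \in \mathcal{M}$, $P(\mu) = [p_{ij}(\mu)]$ with $p_{ij}(\mu) := \sum_u p_{ij}(u)\mu(u|i)$. An irreducible transition probability matrix $P=[p_{ij}]$ with stationary distribution $(\pi_i)$ is reversible if $\pi_i p_{ij} = \pi_j p_{ji}$ for all $i,j$. The data form a reversible Markov decision problem (RMDP) if $P(\mu)$ is irreducible and reversible for every $\mu \in \mathcal{M}$. The canonical graph of an RMDP is the simple connected undirected graph $G = (\mathcal{X},\mathcal{E})$ (no multiple edges, no self-loops, so $(i,i)\notin\mathcal{E}$) such that for all $u \in \mathcal{U}$ and all distinct $i,j \in \mathcal{X}$, $p_{ij}(u) > 0$ if and only if $(i,j) \in \mathcal{E}$ (such a graph exists for every RMDP and is clearly unique). A graph is biconnected if whenever any single vertex, together with all the edges involving that vertex, is removed, the resulting graph continues to be connected. *)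

(* Defs.v *)
From mathcomp Require Import all_boot all_order all_algebra.
From mathcomp Require Import reals.
Set Implicit Arguments.
Unset Strict Implicit.
Unset Printing Implicit Defensive.
Import Order.TTheory GRing.Theory Num.Theory.
Local Open Scope ring_scope.

(* Matrices indexed by a finite type X are functions X -> X -> R, since
   'M[R]_n is only available for ordinal index sets. *)

Definition distribution (R : realType) (T : finType) (p : T -> R) : Prop :=
  (forall x, 0 <= p x) /\ \sum_x p x = 1.

Definition transition_matrix (R : realType) (X : finType)
    (P : X -> X -> R) : Prop :=
  forall i, distribution (P i).

Fixpoint nstep (R : realType) (X : finType) (P : X -> X -> R) (n : nat)
    (i j : X) : R :=
  if n is m.+1 then \sum_k P i k * nstep P m k j else (i == j)%:R.

Definition irreducible (R : realType) (X : finType) (P : X -> X -> R) : Prop :=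
  forall i j, exists n, 0 < nstep P n i j.

Definition stationary (R : realType) (X : finType) (P : X -> X -> R)
    (pi : X -> R) : Prop :=
  distribution pi /\ forall j, \sum_i pi i * P i j = pi j.

(* The stationary distribution of an irreducible transition matrix exists and
   is unique, so quantifying it existentially is the same as naming it. *)
Definition reversible (R : realType) (X : finType) (P : X -> X -> R) : Prop :=
  exists pi, stationary P pi /\ forall i j, pi i * P i j = pi j * P j i.

(* mu i u is the probability mu(u|i) of taking action u in state i. *)
Definition strategy (R : realType) (X U : finType) (mu : X -> U -> R) : Prop :=
  forall i, distribution (mu i).

Definition strategy_matrix (R : realType) (X U : finType)
    (P : U -> X -> X -> R) (mu : X -> U -> R) (i j : X) : R :=
  \sum_u P u i j * mu i u.

(* The reward function carries no constraint, so it is not an argument. *)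
Definition rmdp (R : realType) (X U : finType) (P : U -> X -> X -> R) : Prop :=
  (forall u, transition_matrix (P u)) /\
  (forall mu, strategy mu ->
     irreducible (strategy_matrix P mu) /\ reversible (strategy_matrix P mu)).

Definition simple_graph (X : finType) (E : rel X) : Prop :=
  symmetric E /\ irreflexive E.

(* Connectedness of the subgraph of E induced on A. *)
Definition connected_on (X : finType) (E : rel X) (A : {set X}) : Prop :=
  {in A &, forall i j,
     connect (fun x y => [&& x \in A, y \in A & E x y]) i j}.

Definition connected_graph (X : finType) (E : rel X) : Prop :=
  connected_on E [set: X].

Definition biconnected (X : finType) (E : rel X) : Prop :=
  forall v, connected_on E [set~ v].

Definition canonical_graph (R : realType) (X U : finType)
    (P : U -> X -> X -> R) (E : rel X) : Prop :=
  [/\ simple_graph E, connected_graph E &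
      forall u i j, i != j -> (0 < P u i j <-> E i j)].

(* Main.v *)
Require Import Defs.
From mathcomp Require Import all_boot all_order all_algebra.
From mathcomp Require Import reals.
Set Implicit Arguments.
Unset Strict Implicit.
Unset Printing Implicit Defensive.
Import Order.TTheory GRing.Theory Num.Theory.
Local Open Scope ring_scope.

(** Detailed balance determines how the stationary weights of two neighbouring
    states compare from the transition probabilities of these two states alone.
    Fix a state [i] and two actions [u], [v], and compare the stationary
    distributions [p] and [q] of two deterministic strategies: the one that
    always plays [u], and the one that plays [v] at [i] and [u] elsewhere.
    Along every edge that avoids [i] both satisfy the same balance equation, so
    [q x / p x] does not change along that edge; since the graph stays
    connected when [i] is removed, [q = c * p] on all states other than [i].
    Balance along the edges at [i] then reads
    [p i * P u i j = p j * P u j i] and [q i * P v i j = c * p j * P u j i],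
    which makes the off-diagonal parts of the rows [P u i] and [P v i]
    proportional, with a factor independent of [j]
    ([off_diagonal_rows_proportional]).

    Hence the off-diagonal part of row [i], normalised to total mass one, is the
    same for all actions. These normalised rows form [P0], the jump chain of any
    single [P u], and [rho i u = 1 - P u i i] is the mass that was divided out.
    The jump chain inherits reversibility: if [p] balances [P u], then
    [p i * (1 - P u i i)] balances [P0]. *)

Section Chains.

Variables (R : realType) (X : finType).
Implicit Types (P : X -> X -> R) (E e : rel X) (f g w : X -> R).

Lemma nstep_ge0 P n i j : (forall x y, 0 <= P x y) -> 0 <= nstep P n i j.
Proof.
move=> P_ge0; elim: n i => [|n IHn] i /=; first exact: ler0n.
by apply: sumr_ge0 => k _; rewrite mulr_ge0.
Qed.

Lemma irreducible_of_connect P E :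
  (forall x y, 0 <= P x y) -> (forall x y, E x y -> 0 < P x y) ->
  (forall x y, connect E x y) -> irreducible P.
Proof.
move=> P_ge0 P_gt0 E_conn i j.
have /connectP [s] := E_conn i j.
elim: s i => [|k s IHs] i /=.
  by move=> _ ->; exists 0%N; rewrite /= eqxx ltr01.
case/andP=> Eik s_path j_last; have [n n_gt0] := IHs k s_path j_last.
exists n.+1; rewrite /= (bigD1 k) //= ltr_wpDr ?mulr_gt0 ?P_gt0 //.
by apply: sumr_ge0 => l _; rewrite mulr_ge0 ?nstep_ge0.
Qed.

(** Summing detailed balance over one of the two states gives stationarity, so
    balanced positive weights need only be rescaled to total mass one. *)
Lemma reversible_of_balanced_weights P w (x0 : X) :
  transition_matrix P -> (forall x, 0 < w x) ->
  (forall x y, w x * P x y = w y * P y x) -> reversible P.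
Proof.
move=> P_trans w_gt0 w_bal.
have W_gt0 : 0 < \sum_x w x.
  by rewrite (bigD1 x0) //= ltr_wpDr // sumr_ge0 // => x _; apply: ltW.
exists (fun x => w x / \sum_y w y).
have bal x y : w x / (\sum_z w z) * P x y = w y / (\sum_z w z) * P y x.
  by rewrite mulrAC w_bal mulrAC.
split=> //; split.
  split=> [x|]; first by rewrite divr_ge0 // ltW.
  by rewrite -mulr_suml divff ?gt_eqF.
move=> y; under eq_bigr do rewrite bal.
by rewrite -mulr_sumr; have [_ ->] := P_trans y; rewrite mulr1.
Qed.

Section BalanceAlongEdges.

Variables (e : rel X) (P : X -> X -> R).
Hypothesis P_gt0 : forall x y, e x y -> 0 < P x y /\ 0 < P y x.

(** Across an edge, balanced weights are positive at both ends or at neither. *)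
Lemma balance_gt0 f x y :
  (forall z t, e z t -> f z * P z t = f t * P t z) ->
  connect e x y -> 0 < f x -> 0 < f y.
Proof.
move=> f_bal.
have cl : closed e [pred z | 0 < f z].
  move=> z t ezt; have [Pzt Ptz] := P_gt0 ezt.
  by rewrite !inE -(pmulr_lgt0 (f z) Pzt) f_bal // pmulr_lgt0.
by move/(closed_connect cl); rewrite !inE => ->.
Qed.

(** The balance equation of an edge fixes the ratio of the weights of its two
    ends, hence two solutions differ by a constant factor on each component. *)
Lemma balance_ratio f g x y :
  (forall z, 0 < f z) ->
  (forall z t, e z t -> f z * P z t = f t * P t z) ->
  (forall z t, e z t -> g z * P z t = g t * P t z) ->
  connect e x y -> g x / f x = g y / f y.
Proof.
move=> f_gt0 f_bal g_bal.
have cl : closed e [pred z | g z / f z == g x / f x].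
  move=> z t ezt; have [Pzt Ptz] := P_gt0 ezt; rewrite !inE.
  suff -> : g z / f z = g t / f t by [].
  have f_neq0 s : f s != 0 by apply: lt0r_neq0.
  apply/eqP; rewrite eqr_div //; apply/eqP.
  apply: (mulIf (lt0r_neq0 Pzt)).
  by rewrite mulrAC g_bal // -[RHS]mulrA f_bal // mulrAC mulrA mulrAC.
by move/(closed_connect cl); rewrite !inE eqxx => /esym /eqP ->.
Qed.

End BalanceAlongEdges.

End Chains.

Section RMDP.

Variables (R : realType) (X U : finType) (P : U -> X -> X -> R) (E : rel X).
Hypotheses (hP : rmdp P) (hE : canonical_graph P E).

Lemma canonical_edge_gt0 u v x y : E x y -> 0 < P u x y /\ 0 < P v y x.
Proof.
case: hE => [[E_sym E_irr] _ PE] Exy.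
have xy : x != y by apply: contraTneq Exy => ->; rewrite E_irr.
by split; apply/PE; rewrite // 1?eq_sym // E_sym.
Qed.

Lemma canonical_connect x y : connect E x y.
Proof.
case: hE => _ /(_ x y (in_setT x) (in_setT y)) xy _.
by apply: connect_sub xy => z t /and3P [_ _ Ezt]; apply: connect1.
Qed.

(** Positivity of the stationary distribution follows from connectedness: it
    is positive somewhere because its total mass is one. *)
Lemma deterministic_balance (a : X -> U) :
  exists w : X -> R, (forall x, 0 < w x) /\
    forall x y, w x * P (a x) x y = w y * P (a y) y x.
Proof.
pose mu x v : R := (v == a x)%:R.
have mu_sum (F : U -> R) x : \sum_v F v * mu x v = F (a x).
  rewrite (bigD1 (a x)) //= /mu eqxx mulr1 big1 ?addr0 // => v /negPf ->.
  by rewrite mulr0.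
have mu_strat : strategy mu.
  move=> x; split=> [v|]; first exact: ler0n.
  by rewrite -[RHS](mu_sum (fun=> 1) x); apply: eq_bigr => v _; rewrite mul1r.
case: hP => _ /(_ mu mu_strat) [_ [w [[[w_ge0 w_sum] _] w_bal]]].
have bal x y : w x * P (a x) x y = w y * P (a y) y x.
  by have := w_bal x y; rewrite /strategy_matrix !mu_sum.
exists w; split=> // y.
have [x w_x] : exists x, 0 < w x.
  have [x wx_gt0|w0] := pickP [pred x | 0 < w x]; first by exists x.
  move: w_sum; rewrite big1 => [/esym /eqP|x _]; first by rewrite oner_eq0.
  by apply/eqP; have := w0 x; rewrite /= lt_def w_ge0 andbT => /negbFE.
apply: (@balance_gt0 R X E (fun x y => P (a x) x y)) w_x => //.
  by move=> z t; apply: canonical_edge_gt0.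
exact: canonical_connect.
Qed.

Lemma off_diagonal_sum u i : \sum_(j | j != i) P u i j = 1 - P u i i.
Proof.
case: hP => /(_ u i) [_ sum1] _.
by rewrite -sum1 [in RHS](bigD1 i) //= [P u i i + _]addrC addrK.
Qed.

(** Strict positivity needs a second state: the first edge of a path leading
    to it is a transition out of [i]. *)
Lemma exit_prob_gt0 u i : (2 <= #|X|)%N -> 0 < 1 - P u i i.
Proof.
move=> hX; have [j ji] : exists j, j != i.
  have : (0 < #|[set~ i]|)%N by rewrite cardsC1; case: #|X| hX => [|[]].
  by case/card_gt0P=> j; rewrite !inE; exists j.
have /connectP [[|k s] /=] := canonical_connect i j.
  by move=> _ jeq; rewrite jeq eqxx in ji.
case/andP=> Eik _ _; have [Pik _] := canonical_edge_gt0 u u Eik.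
have ki : k != i.
  by case: hE => [[_ E_irr] _ _]; apply: contraTneq Eik => ->; rewrite E_irr.
rewrite -off_diagonal_sum (bigD1 k) //= ltr_wpDr // sumr_ge0 // => l _.
by case: hP => /(_ u i) [].
Qed.

(** Changing the action at [i] alone rescales the stationary distribution by a
    constant away from [i]; the balance equations at [i] transfer this constant
    to row [i]. *)
Lemma off_diagonal_rows_proportional u v i :
  biconnected E ->
  exists c, forall j, j != i -> P v i j = c * P u i j.
Proof.
move=> hB; have [j0 j0i|only_i] := pickP [pred j | j != i]; last first.
  by exists 0 => j ji; have := only_i j; rewrite /= ji.
have [p [p_gt0 p_bal]] := deterministic_balance (fun=> u).
have [q [q_gt0 q_bal]] :=
  deterministic_balance (fun x => if x == i then v else u).
have ratio j : j != i -> q j / p j = q j0 / p j0.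
  move=> ji.
  have := hB i j j0; rewrite !inE => /(_ ji j0i).
  apply: (balance_ratio (P := P u)) => //.
    by move=> x y /and3P [_ _ Exy]; apply: canonical_edge_gt0.
  move=> x y; rewrite !inE => /and3P [/negPf xi /negPf yi _].
  by have := q_bal x y; rewrite xi yi.
exists (q j0 / p j0 * p i / q i) => j ji.
have qj : q j = q j0 / p j0 * p j by rewrite -(ratio j ji) divfK ?gt_eqF.
apply: (mulfI (lt0r_neq0 (q_gt0 i))).
have := q_bal i j; rewrite eqxx (negPf ji) => ->.
rewrite qj -[LHS]mulrA -p_bal [RHS]mulrA [q i * _]mulrC.
by rewrite divfK ?mulrA // gt_eqF.
Qed.

End RMDP.

Theorem theorem1 (R : realType) (X U : finType)
    (hX : (2 <= #|X|)%N) (hU : (2 <= #|U|)%N)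
    (P : U -> X -> X -> R) (r : X -> U -> R) (hP : rmdp P)
    (E : rel X) (hE : canonical_graph P E) (hB : biconnected E) :
  exists (P0 : X -> X -> R) (rho : X -> U -> R),
    [/\ transition_matrix P0, irreducible P0, reversible P0 &
        forall i j, 0 < P0 i j <-> E i j] /\
    (forall i u, 0 < rho i u <= 1) /\
    (forall u i,
       (forall j, j != i -> P u i j = rho i u * P0 i j) /\
       P u i i = 1 - rho i u).
Proof.
have [u0 _] : exists u0 : U, true by have /card_gt0P [u0 _] := ltnW hU; exists u0.
have [x0 _] : exists x0 : X, true by have /card_gt0P [x0 _] := ltnW hX; exists x0.
pose rho i u := 1 - P u i i.
have rho_gt0 i u : 0 < rho i u by apply: (exit_prob_gt0 hP hE).
have rho_neq0 i u : rho i u != 0 by rewrite gt_eqF.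
have P_ge0 u i j : 0 <= P u i j by case: hP => /(_ u i) [].
pose P0 i j := if j == i then 0 else P u0 i j / rho i u0.
have P0_ge0 i j : 0 <= P0 i j.
  by rewrite /P0; case: ifP => // _; rewrite divr_ge0 // ltW.
have P0_trans : transition_matrix P0.
  move=> i; split=> //; rewrite (bigD1 i) //= {1}/P0 eqxx add0r.
  rewrite -(divff (rho_neq0 i u0)) -[X in X / _](off_diagonal_sum hP) mulr_suml.
  by apply: eq_bigr => j /negPf ji; rewrite /P0 ji.
have [[_ E_irr] _ PE] := hE.
have P0E i j : 0 < P0 i j <-> E i j.
  rewrite /P0; have [->|ji] := eqVneq j i; first by rewrite ltxx E_irr.
  by rewrite pmulr_lgt0 ?invr_gt0 //; apply: PE; rewrite eq_sym.
exists P0, rho; split; [split=> //|split].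
- apply: (irreducible_of_connect P0_ge0 (fun i j => (P0E i j).2)).
  exact: (canonical_connect hE).
- have [w [w_gt0 w_bal]] := deterministic_balance hP hE (fun=> u0).
  apply: (@reversible_of_balanced_weights _ _ _ (fun i => w i * rho i u0) x0) => //.
    by move=> i; rewrite mulr_gt0.
  move=> i j; rewrite /P0 [i == j]eq_sym; case: eqP => _; first by rewrite !mulr0.
  by rewrite -!mulrA ![rho _ _ * _]mulrC !divfK.
- by move=> i u; rewrite rho_gt0 gerBl P_ge0.
move=> u i; split; last by rewrite /rho opprB addrC subrK.
move=> j ji; rewrite /P0 (negPf ji).
have [c P_prop] := off_diagonal_rows_proportional hP hE u0 u i hB.
(* Summing the proportionality over the row identifies the factor [c]. *)
have -> : rho i u = c * rho i u0.
  rewrite /rho -!(off_diagonal_sum hP) mulr_sumr.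
  by apply: eq_bigr => k; apply: P_prop.
by rewrite P_prop // -mulrA [rho _ _ * _]mulrC divfK.
Qed.
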